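(* Let $\psi(x)=x^2+\frac14$, let $\mu\in\mathbb{C}$ with $|\mu|>1$, and let $R_\mu=\sum_{m=0}^\infty\frac{C_{\psi_m}}{\mu^{m+1}}$. Then: (1) Let $1<d<2$. For every strong weight $\omega$ there is $f\in\mathcal{S}_\omega(\mathbb{R})$ such that $R_\mu f\notin\Sigma_d(\mathbb{R})$. (2) Let $d,d'>1$ be such that $d'<d+2$. Then there is $f\in\Sigma_d(\mathbb{R})$ such that $R_\mu f\notin\Sigma_{d'}(\mathbb{R})$.
   Context: $\mathbb{N}_0=\{0,1,2,\dots\}$. A weight is a continuous increasing function $\omega:[0,\infty[\to[0,\infty[$ such that: $(\alpha)$ there is $K\ge 1$ with $\omega(2t)\le K(\omega(t)+1)$ for all $t\ge 0$; $(\beta)$ $\int_0^\infty \frac{\omega(t)}{1+t^2}\,dt<\infty$; $(\gamma)$ $\log(1+t^2)=o(\omega(t))$ as $t\to\infty$; $(\delta)$ $\varphi_\omega(t):=\omega(e^t)$ is convex. A weight is a strong weight if in addition $(\varepsilon)$ there is $C\ge1$ such that $\int_1^\infty\frac{\omega(yt)}{t^2}\,dt\le C\omega(y)+C$ for all $y>0$. The Young conjugate of $\varphi_\omega$ is $\varphi_\omega^*(s)=\sup\{st-\varphi_\omega(t): t\ge 0\}$, $s\ge 0$. The Gelfand-Shilov space of Beurling type $\mathcal{S}_\omega(\mathbb{R})$ is the space of all $f\in C^\infty(\mathbb{R})$ (complex valued) with $$\|f\|_{\omega,\lambda}:=\sup_{x\in\mathbb{R}}\sup_{n,q\in\mathbb{N}_0}(1+|x|)^q|f^{(n)}(x)|\exp\left(-\lambda\varphi_\omega^*\left(\tfrac{n+q}{\lambda}\right)\right)<\infty\quad\text{for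 every }\lambda>0,$$ a Fréchet space contained in the Schwartz space $\mathcal{S}(\mathbb{R})$. For $d>1$, $\Sigma_d(\mathbb{R}):=\mathcal{S}_\omega(\mathbb{R})$ with $\omega(t)=t^{1/d}$. $C_\phi$ is the composition operator $f\mapsto f\circ\phi$; $\psi_m$ is the $m$-th iterate of $\psi$ under composition ($\psi_0$ the identity). It is known that for $\psi(x)=x^2+\frac14$ and $|\mu|>1$ the operator $\mu I-C_\psi$ is a topological isomorphism of $\mathcal{S}(\mathbb{R})$ and that $R_\mu f=\sum_{m=0}^\infty\frac{C_{\psi_m}f}{\mu^{m+1}}$ converges in $\mathcal{S}(\mathbb{R})$ to $(\mu I-C_\psi)^{-1}f$ for every $f\in\mathcal{S}(\mathbb{R})$. *)

(* Defs.v *)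
From Stdlib Require Import Reals Lra Lia.
From Coquelicot Require Import Coquelicot.
Open Scope R_scope.

(* Functions on [0, oo[ are represented by total functions on R whose values
   at negative arguments are irrelevant: no condition below mentions them. *)

Definition convex_fun (g : R -> R) : Prop :=
  forall s t a : R, 0 <= a <= 1 ->
    g (a * s + (1 - a) * t) <= a * g s + (1 - a) * g t.

Definition phi_ (omega : R -> R) (t : R) : R := omega (exp t).

(* [increasing] is taken in the wide sense, so that weights vanishing near the
   origin are allowed. *)
Record weight (omega : R -> R) : Prop := {
  weight_ge0 : forall t, 0 <= t -> 0 <= omega t;
  weight_continuous : continuous_on (fun t => 0 <= t) omega;
  weight_increasing : forall s t, 0 <= s -> s <= t -> omega s <= omega t;
  weight_alpha : exists K, 1 <= K /\
    forall t, 0 <= t -> omega (2 * t) <= K * (omega t + 1);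
  weight_beta : ex_RInt_gen (fun t => omega t / (1 + t ^ 2))
                  (at_point 0) (Rbar_locally p_infty);
  (* [is_domin F f g] means g = o(f) along F. *)
  weight_gamma : is_domin (Rbar_locally p_infty)
                   omega (fun t => ln (1 + t ^ 2));
  weight_delta : convex_fun (phi_ omega)
}.

Record strong_weight (omega : R -> R) : Prop := {
  strong_weight_weight : weight omega;
  strong_weight_epsilon : exists C, 1 <= C /\ forall y, 0 < y ->
    ex_RInt_gen (fun t => omega (y * t) / t ^ 2)
      (at_point 1) (Rbar_locally p_infty) /\
    RInt_gen (fun t => omega (y * t) / t ^ 2)
      (at_point 1) (Rbar_locally p_infty) <= C * omega y + C
}.

(* The supremum is finite when omega is a weight, see [young_conj_finite]. *)
Definition young_conj (omega : R -> R) (s : R) : R :=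
  real (Lub_Rbar (fun r => exists t, 0 <= t /\ r = s * t - phi_ omega t)).

Lemma young_conj_finite (omega : R -> R) (s : R) :
  weight omega -> 0 <= s ->
  is_finite (Lub_Rbar (fun r => exists t, 0 <= t /\ r = s * t - phi_ omega t)).
Proof.
intros W Hs.
assert (He : 0 < 2 / (s + 1)) by (apply Rdiv_lt_0_compat; lra).
destruct (weight_gamma _ W (mkposreal _ He)) as [M HM]; simpl in HM.
match goal with |- is_finite (Lub_Rbar ?E) => set (S := E) end.
destruct (Lub_Rbar_correct S) as [Hub Hlub].
assert (H0 : S (s * 0 - phi_ omega 0)) by (exists 0; split; [lra | reflexivity]).
apply Hub in H0.
assert (HB : Rbar_le (Lub_Rbar S) (s * Rabs M)).
{ apply Hlub; intros r [t [Ht ->]]; simpl; unfold phi_.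
  assert (Hexp : t < exp t) by (generalize (exp_ineq1_le t); lra).
  pose proof (weight_ge0 _ W (exp t) (Rlt_le _ _ (exp_pos t))) as Hge.
  assert (HsM : 0 <= s * Rabs M) by (apply Rmult_le_pos; [lra | apply Rabs_pos]).
  destruct (Rle_lt_dec (exp t) M) as [Hle | Hlt].
  - assert (s * t <= s * Rabs M); [| lra].
    apply Rmult_le_compat_l; [lra |]. generalize (Rle_abs M); lra.
  - specialize (HM _ Hlt).
    change (Rabs (ln (1 + exp t * (exp t * 1)))
              <= 2 / (s + 1) * Rabs (omega (exp t))) in HM.
    rewrite (Rabs_pos_eq (omega _)) in HM by exact Hge.
    assert (Hln : 2 * t <= ln (1 + exp t * (exp t * 1))).
    { rewrite <- (ln_exp (2 * t)).
      replace (2 * t) with (t + t) by ring. rewrite exp_plus.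
      pose proof (exp_pos t) as Hp.
      assert (0 < exp t * exp t) by (apply Rmult_lt_0_compat; lra).
      apply Rlt_le, ln_increasing; lra. }
    pose proof (Rle_abs (ln (1 + exp t * (exp t * 1)))) as Ha.
    assert (H2 : (s + 1) * (2 * t) <= (s + 1) * (2 / (s + 1) * omega (exp t)))
      by (apply Rmult_le_compat_l; lra).
    replace ((s + 1) * (2 / (s + 1) * omega (exp t)))
      with (2 * omega (exp t)) in H2 by (field; lra).
    nra. }
destruct (Lub_Rbar S); simpl in *; try reflexivity; contradiction.
Qed.

(* Derivatives of complex-valued functions of a real variable. *)
Definition smooth (f : R -> C) : Prop :=
  forall (n : nat) (x : R),
    ex_derive_n (fun y => Re (f y)) n x /\ ex_derive_n (fun y => Im (f y)) n x.

Definition CDerive_n (f : R -> C) (n : nat) (x : R) : C :=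
  (Derive_n (fun y => Re (f y)) n x, Derive_n (fun y => Im (f y)) n x).

Definition gs_norm (omega : R -> R) (lambda : R) (f : R -> C) : Rbar :=
  Lub_Rbar (fun r => exists (x : R) (n q : nat),
    r = (1 + Rabs x) ^ q * Cmod (CDerive_n f n x)
        * exp (- lambda * young_conj omega (INR (n + q) / lambda))).

Definition gelfand_shilov (omega : R -> R) (f : R -> C) : Prop :=
  smooth f /\
  forall lambda : R, 0 < lambda -> Rbar_lt (gs_norm omega lambda f) p_infty.

(* t^(1/d) on [0, oo[; the case split is needed because [Rpower 0 y = 1]. *)
Definition power_weight (d t : R) : R :=
  if Rle_dec t 0 then 0 else Rpower t (1 / d).

Definition Sigma_space (d : R) : (R -> C) -> Prop :=
  gelfand_shilov (power_weight d).

Definition comp_op (phi : R -> R) (f : R -> C) : R -> C := fun x => f (phi x).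

Definition psi (x : R) : R := x ^ 2 + 1 / 4.

Definition psi_iter (m : nat) : R -> R := Nat.iter m psi.

Definition CSeries (a : nat -> C) : C :=
  (Series (fun m => Re (a m)), Series (fun m => Im (a m))).

(* The sum of the series at each point; a sum in the Schwartz space is
   necessarily this one. For bounded f, in particular for Schwartz functions,
   the series does converge at every point, see [resolvent_is_series]. *)
Definition resolvent (mu : C) (f : R -> C) : R -> C :=
  fun x => CSeries (fun m => (comp_op (psi_iter m) f x / mu ^ S m)%C).

Lemma is_series_CSeries (a : nat -> C) :
  ex_series (fun m => Cmod (a m)) ->
  is_series (V := C_R_NormedModule) a (CSeries a).
Proof.
intros Ha.
assert (HR : ex_series (fun m => Re (a m))).
{ apply ex_series_Rabs.
  apply (ex_series_le (V := R_CompleteNormedModule) _ (fun m => Cmod (a m)));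
    [| exact Ha].
  intros m. change (Rabs (Rabs (Re (a m))) <= Cmod (a m)).
  rewrite Rabs_Rabsolu. apply re_le_Cmod. }
assert (HI : ex_series (fun m => Im (a m))).
{ apply ex_series_Rabs.
  apply (ex_series_le (V := R_CompleteNormedModule) _ (fun m => Cmod (a m)));
    [| exact Ha].
  intros m. change (Rabs (Rabs (Im (a m))) <= Cmod (a m)).
  rewrite Rabs_Rabsolu. exact (Rle_trans _ _ _ (Rmax_r _ _) (Rmax_Cmod (a m))). }
apply Series_correct in HR. apply Series_correct in HI.
unfold is_series in *.
apply (filterlim_ext (fun n => (sum_n (fun m => Re (a m)) n,
                                sum_n (fun m => Im (a m)) n) : C)).
{ intros n; induction n as [| n IH].
  - rewrite !sum_O. destruct (a 0%nat); reflexivity.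
  - rewrite !sum_Sn, <- IH. destruct (a (S n)); reflexivity. }
intros P [eps HP].
assert (E1 := HR (fun y => ball (Series (fun m => Re (a m))) eps y)
                (locally_ball _ eps)).
assert (E2 := HI (fun y => ball (Series (fun m => Im (a m))) eps y)
                (locally_ball _ eps)).
unfold filtermap in *.
generalize (filter_and _ _ E1 E2). apply filter_imp.
intros n [B1 B2]. apply HP. split; assumption.
Qed.

Lemma resolvent_is_series (mu : C) (f : R -> C) (M : R) (x : R) :
  1 < Cmod mu -> (forall y, Cmod (f y) <= M) ->
  is_series (V := C_R_NormedModule)
    (fun m => (comp_op (psi_iter m) f x / mu ^ S m)%C) (resolvent mu f x).
Proof.
intros Hmu HM. apply is_series_CSeries.
assert (Hq : 0 < / Cmod mu < 1).
{ split; [apply Rinv_0_lt_compat; lra |].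
  rewrite <- Rinv_1. apply Rinv_lt_contravar; lra. }
assert (Hmu0 : mu <> RtoC 0).
{ intros ->. rewrite Cmod_0 in Hmu. lra. }
apply (ex_series_le (V := R_CompleteNormedModule) _
         (fun m => (M * / Cmod mu) * (/ Cmod mu) ^ m)).
- intros m.
  change (Rabs (Cmod (comp_op (psi_iter m) f x / mu ^ S m))
            <= M * / Cmod mu * (/ Cmod mu) ^ m).
  rewrite Rabs_pos_eq by apply Cmod_ge_0.
  rewrite Cmod_div by (apply Cpow_nz; exact Hmu0).
  rewrite Cmod_pow. unfold Rdiv. rewrite pow_inv.
  replace (M * / Cmod mu * / Cmod mu ^ m) with (M * / Cmod mu ^ S m).
  2: { simpl. field. split; [apply pow_nonzero |]; lra. }
  apply Rmult_le_compat_r; [| apply HM].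
  apply Rlt_le, Rinv_0_lt_compat, pow_lt; lra.
- apply (ex_series_scal_l (K := R_AbsRing) (M * / Cmod mu) (fun m => (/ Cmod mu) ^ m)).
  apply ex_series_geom. rewrite Rabs_pos_eq; lra.
Qed.

(* Main.v *)
Require Import Defs.
From Stdlib Require Import Reals Lra Lia Factorial Compare_dec.
From Coquelicot Require Import Coquelicot.
Open Scope R_scope.

(** A bump f supported in [1, 65/64] meets each orbit of psi at most once, since
    psi(1) = 5/4: wherever psi_m lies in [7/8, 65/64], R_mu f is the single term
    f(psi_m) / mu^(m+1), so nothing can cancel and only |mu| matters. The parabolic
    fixed point 1/2 makes psi_m expand by a factor of order m^2 near psi_m^{-1}(1).
    Take f(x) = exp(-(x-1)^(-p) - (65/64-x)^(-p)), of Gevrey order 1 + 1/p. At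
    distance O(h/m^2) from a point near which R_mu f vanishes identically it takes
    the value f(1+h)/mu^(m+1), and Taylor's formula with m = n and h = n^(-1/p)
    forces derivatives of size n!^(3+1/p) up to a geometric factor. The
    second assertion follows by choosing 1 + 1/p in (max(1, d'-2), d). For the first
    one, a strong weight is O(t^(1/e)) for some e > 1, so f with 1 + 1/p < e will do. *)

(** * Elementary estimates for factorials and exponentials *)

(** The induction step is [(k+1)^k <= k^k * e], which follows from [1 + 1/k <= exp (1/k)]. *)
Lemma pow_self_le_fact (n : nat) : INR n ^ n <= INR (fact n) * exp (INR n).
Proof.
induction n as [| n IH]; [simpl; rewrite exp_0; lra |].
destruct n as [| n].
- simpl. generalize (exp_ineq1_le 1). lra.
- remember (S n) as k eqn:Ek.
  assert (Hk : 0 < INR k) by (subst; apply lt_0_INR; lia).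
  assert (E : INR (S k) ^ k <= INR k ^ k * exp 1).
  { replace (INR (S k)) with (INR k * (1 + / INR k))
      by (rewrite S_INR; field; lra).
    rewrite Rpow_mult_distr.
    apply Rmult_le_compat_l; [apply pow_le; lra |].
    apply Rle_trans with (exp (/ INR k) ^ k).
    - apply pow_incr; split; [| apply exp_ineq1_le].
      assert (0 < / INR k) by (apply Rinv_0_lt_compat; lra). lra.
    - rewrite <- Rpower_pow by apply exp_pos. unfold Rpower.
      rewrite ln_exp. right; f_equal; field; lra. }
  replace (exp (INR (S k))) with (exp (INR k) * exp 1)
    by (rewrite <- exp_plus, S_INR; reflexivity).
  change (fact (S k)) with (S k * fact k)%nat. rewrite mult_INR.
  change (INR (S k) ^ S k) with (INR (S k) * INR (S k) ^ k).
  rewrite !Rmult_assoc. apply Rmult_le_compat_l; [apply pos_INR |].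
  apply Rle_trans with (1 := E). rewrite <- Rmult_assoc.
  apply Rmult_le_compat_r; [apply Rlt_le, exp_pos | exact IH].
Qed.

Lemma exp_le_exp (x y : R) : x <= y -> exp x <= exp y.
Proof.
intros [H | ->]; [apply Rlt_le, exp_increasing, H | apply Rle_refl].
Qed.

(** In the variable [w = v - ln z'] the claim is [z * w <= z' * exp w]: a matter of signs for
    [w <= 0], and a consequence of [w <= exp w] otherwise. Using [z'] inside the logarithm allows
    [z = 0]. *)
Lemma mul_sub_exp_le (z z' v : R) :
  0 <= z <= z' -> 0 < z' -> z * v - exp v <= z * ln z'.
Proof.
intros Hz Hz'.
assert (E : exp v = z' * exp (v - ln z')).
{ rewrite <- (exp_ln z' Hz') at 1. rewrite <- exp_plus. f_equal; ring. }
rewrite E. set (w := v - ln z'). replace v with (w + ln z') by (unfold w; ring).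
pose proof (exp_ineq1_le w) as Hw. pose proof (exp_pos w) as Hp.
destruct (Rle_lt_dec w 0); nra.
Qed.

(** * Towers of derivatives and products *)

(** All derivatives are carried along as explicit functions, so that bounds can be read off
    recursive formulas; [Derive_n] enters only at the end. *)
Definition derivative_tower (u : nat -> R -> R) : Prop :=
  forall n x, is_derive (u n) x (u (S n) x).

Lemma derivative_tower_Derive_n (u : nat -> R -> R) (n : nat) (x : R) :
  derivative_tower u -> Derive_n (u O) n x = u n x.
Proof.
intros Hu. revert x; induction n as [| n IH]; intros x; [reflexivity |].
simpl. rewrite (Derive_ext _ _ x IH). apply is_derive_unique, Hu.
Qed.

Lemma derivative_tower_ex_derive_n (u : nat -> R -> R) (n : nat) (x : R) :
  derivative_tower u -> ex_derive_n (u O) n x.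
Proof.
intros Hu. destruct n as [| n]; [exact I |].
apply (ex_derive_ext (u n)).
- intros y. symmetry. now apply derivative_tower_Derive_n.
- eexists; apply Hu.
Qed.

(* Leibniz's formula without binomial coefficients:
   [product_tower u v n i j] is the [n]-th derivative of [u i * v j]. *)
Fixpoint product_tower (u v : nat -> R -> R) (n i j : nat) (x : R) : R :=
  match n with
  | O => u i x * v j x
  | S n => product_tower u v n (S i) j x + product_tower u v n i (S j) x
  end.

Lemma derivative_tower_product (u v : nat -> R -> R) (i j : nat) :
  derivative_tower u -> derivative_tower v ->
  derivative_tower (fun n => product_tower u v n i j).
Proof.
intros Hu Hv n. revert i j.
induction n as [| n IH]; intros i j x; simpl.
- apply (is_derive_mult (u i) (v j) x); [apply Hu | apply Hv | exact Rmult_comm].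
- apply (is_derive_plus (product_tower u v n (S i) j) (product_tower u v n i (S j)));
    apply IH.
Qed.

Lemma product_tower_eq0 (u v : nat -> R -> R) (n i j : nat) (x : R) :
  (forall k, u k x = 0) \/ (forall k, v k x = 0) ->
  product_tower u v n i j x = 0.
Proof.
intros H. revert i j; induction n as [| n IH]; intros i j; simpl.
- destruct H as [H | H]; rewrite H; ring.
- rewrite !IH; ring.
Qed.

(** Unfolding the recursion gives [2^n] products [u k * v l], all with [k + l = n + i + j]. *)
Lemma product_tower_le (u v : nat -> R -> R) (M : nat -> R) (n i j : nat) (x : R) :
  (forall i j, Rabs (u i x) * Rabs (v j x) <= M (i + j)%nat) ->
  Rabs (product_tower u v n i j x) <= 2 ^ n * M (n + i + j)%nat.
Proof.
intros H. revert i j; induction n as [| n IH]; intros i j; simpl.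
- rewrite Rabs_mult. specialize (H i j). lra.
- apply Rle_trans with (1 := Rabs_triang _ _).
  generalize (IH (S i) j) (IH i (S j)).
  replace (n + S i + j)%nat with (S (n + i + j)) by lia.
  replace (n + i + S j)%nat with (S (n + i + j)) by lia. lra.
Qed.

(** * The flat function exp(-x^(-p)) and its derivatives *)

(* The [n]-th derivative of [x^(-a) exp (- x^(-p))] on [x > 0]. *)
Fixpoint flat_deriv (p : R) (n : nat) (a x : R) : R :=
  match n with
  | O => Rpower x (- a) * exp (- Rpower x (- p))
  | S n => p * flat_deriv p n (a + p + 1) x - a * flat_deriv p n (a + 1) x
  end.

Lemma is_derive_flat_deriv (p : R) (n : nat) (a x : R) :
  0 < x -> is_derive (flat_deriv p n a) x (flat_deriv p (S n) a x).
Proof.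
intros Hx. revert a; induction n as [| n IH]; intros a.
- simpl. unfold Rpower. auto_derive; [lra |].
  assert (E : forall b, exp (- (b + 1) * ln x) = exp (- b * ln x) * / x).
  { intros b. replace (- (b + 1) * ln x) with (- b * ln x + - ln x) by ring.
    now rewrite exp_plus, exp_Ropp, exp_ln. }
  rewrite !E.
  replace (exp (- (a + p) * ln x)) with (exp (- a * ln x) * exp (- p * ln x))
    by (rewrite <- exp_plus; f_equal; ring).
  field; lra.
- apply (is_derive_minus (fun y => p * flat_deriv p n (a + p + 1) y)
                         (fun y => a * flat_deriv p n (a + 1) y));
    apply is_derive_scal, IH.
Qed.

(** With [v = - p * ln x] the function is [exp (a / p * v - exp v)], so [mul_sub_exp_le] bounds it
    uniformly in [x]. *)
Lemma flat_deriv_0_le (p a x : R) :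
  0 < p -> 0 <= a ->
  0 <= flat_deriv p 0 a x <= Rpower ((1 + / p) * (a + 1)) (a / p).
Proof.
intros Hp Ha. assert (Hip : 0 < / p) by (apply Rinv_0_lt_compat; lra).
simpl. unfold Rpower. rewrite <- exp_plus. split; [apply Rlt_le, exp_pos |].
apply exp_le_exp.
replace (- a * ln x) with (a / p * (- p * ln x)) by (field; lra).
apply (mul_sub_exp_le (a / p)); [| nra].
split; unfold Rdiv; nra.
Qed.

(** Each differentiation raises the exponent [a] by [p + 1], or by 1 at the cost of a factor [a]. In
    the second case the final exponent is smaller by [p], so the power in the bound is smaller by
    one, and this pays for the factor. *)
Lemma flat_deriv_le (p : R) (n : nat) (a x : R) :
  0 < p -> 0 <= a ->
  Rabs (flat_deriv p n a x) <=
    (p + 1) ^ n * Rpower ((1 + / p) * (a + INR n * (p + 1) + 1))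
                         ((a + INR n * (p + 1)) / p).
Proof.
intros Hp. assert (Hip : 0 < / p) by (apply Rinv_0_lt_compat; lra).
revert a; induction n as [| n IH]; intros a Ha.
- replace (a + INR 0 * (p + 1)) with a by (simpl; ring).
  rewrite Rabs_pos_eq by (apply flat_deriv_0_le; lra).
  rewrite pow_O, Rmult_1_l. apply flat_deriv_0_le; lra.
- simpl flat_deriv.
  assert (H1 := IH (a + p + 1) ltac:(lra)). assert (H2 := IH (a + 1) ltac:(lra)).
  pose proof (pos_INR n) as Hn.
  set (N := a + INR (S n) * (p + 1)) in *.
  assert (EN : N = a + (INR n + 1) * (p + 1)) by (unfold N; rewrite S_INR; ring).
  replace (a + p + 1 + INR n * (p + 1)) with N in H1 by (rewrite EN; ring).
  replace (a + 1 + INR n * (p + 1)) with (N - p) in H2 by (rewrite EN; ring).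
  set (B := (1 + / p) * (N + 1)) in *.
  assert (HnP : 0 <= INR n * (p + 1)) by nra.
  assert (HN : N <= B) by (unfold B; nra).
  assert (H3 : a * Rpower ((1 + / p) * (N - p + 1)) ((N - p) / p)
               <= Rpower B (N / p)).
  { replace (N / p) with (1 + (N - p) / p) by (field; lra).
    rewrite Rpower_plus, Rpower_1 by nra.
    apply Rmult_le_compat; [lra | apply Rlt_le, exp_pos | nra |].
    apply Rle_Rpower_l.
    - unfold Rdiv. apply Rmult_le_pos; lra || nra.
    - unfold B; split; nra. }
  apply Rle_trans with (1 := Rabs_triang _ _).
  rewrite Rabs_Ropp, !Rabs_mult, (Rabs_pos_eq p), (Rabs_pos_eq a) by lra.
  assert (H4 : 0 < (p + 1) ^ n) by (apply pow_lt; lra).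
  apply Rle_trans with (p * ((p + 1) ^ n * Rpower B (N / p)) +
    a * ((p + 1) ^ n * Rpower ((1 + / p) * (N - p + 1)) ((N - p) / p))).
  + apply Rplus_le_compat; apply Rmult_le_compat_l; lra.
  + simpl pow. nra.
Qed.

(** Quadratic vanishing at the origin, which is what makes the extension by zero differentiable
    there at every order. It comes from writing [x^(-a) = x^(-(a+2)) * x^2]. *)
Lemma flat_deriv_le_sqr (p : R) (n : nat) (a : R) :
  0 < p -> 0 <= a ->
  exists K, forall x, 0 < x -> Rabs (flat_deriv p n a x) <= K * x ^ 2.
Proof.
intros Hp. revert a; induction n as [| n IH]; intros a Ha.
- eexists; intros x Hx.
  rewrite Rabs_pos_eq by (apply flat_deriv_0_le; lra).
  replace (flat_deriv p 0 a x) with (flat_deriv p 0 (a + 2) x * x ^ 2).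
  + apply Rmult_le_compat_r; [apply pow2_ge_0 |].
    apply flat_deriv_0_le; lra.
  + simpl. change (x * (x * 1)) with (x ^ 2). rewrite <- (Rpower_pow 2 x Hx).
    replace (- a) with (- (a + 2) + INR 2) by (simpl; ring).
    rewrite Rpower_plus. ring.
- destruct (IH (a + p + 1)) as [K1 H1]; [lra |].
  destruct (IH (a + 1)) as [K2 H2]; [lra |].
  exists (p * K1 + a * K2); intros x Hx. simpl flat_deriv.
  apply Rle_trans with (1 := Rabs_triang _ _).
  rewrite Rabs_Ropp, !Rabs_mult, (Rabs_pos_eq p), (Rabs_pos_eq a) by lra.
  generalize (H1 x Hx) (H2 x Hx). nra.
Qed.

Definition flat (p : R) (n : nat) (x : R) : R :=
  if Rle_dec x 0 then 0 else flat_deriv p n 0 x.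

Lemma flat_neg (p : R) (n : nat) (x : R) : x <= 0 -> flat p n x = 0.
Proof. intros H. unfold flat. destruct (Rle_dec x 0); [reflexivity | lra]. Qed.

Lemma flat_pos (p : R) (n : nat) (x : R) :
  0 < x -> flat p n x = flat_deriv p n 0 x.
Proof. intros H. unfold flat. destruct (Rle_dec x 0); [lra | reflexivity]. Qed.

Lemma derivative_tower_flat (p : R) : 0 < p -> derivative_tower (flat p).
Proof.
intros Hp n x. destruct (total_order_T x 0) as [[Hx | Hx] | Hx].
- rewrite flat_neg by lra.
  apply (is_derive_ext_loc (fun _ => 0)); [| apply @is_derive_const].
  apply (filter_imp (fun y => y < 0)); [| now apply open_lt].
  intros y Hy. rewrite flat_neg; lra.
- subst x. rewrite flat_neg by lra.
  destruct (flat_deriv_le_sqr p n 0 Hp (Rle_refl 0)) as [K HK].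
  assert (H : forall y, Rabs (flat p n y) <= Rabs K * y ^ 2).
  { intros y. pose proof (Rabs_pos K). pose proof (pow2_ge_0 y).
    destruct (Rle_lt_dec y 0).
    - rewrite flat_neg, Rabs_R0 by lra. nra.
    - rewrite flat_pos by lra. pose proof (HK y r). pose proof (Rle_abs K). nra. }
  apply is_derive_Reals. intros eps Heps.
  assert (Hd : 0 < eps / (Rabs K + 1)).
  { apply Rdiv_lt_0_compat; [lra |]. pose proof (Rabs_pos K). lra. }
  exists (mkposreal _ Hd). simpl. intros h Hh0 Hh.
  rewrite Rplus_0_l, (flat_neg p n 0), !Rminus_0_r by lra.
  unfold Rdiv. rewrite Rabs_mult, Rabs_inv.
  pose proof (Rabs_pos_lt h Hh0) as Hpos.
  apply Rle_lt_trans with (Rabs K * Rabs h).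
  + apply Rle_trans with (Rabs K * h ^ 2 * / Rabs h).
    * apply Rmult_le_compat_r; [apply Rlt_le, Rinv_0_lt_compat; lra | apply H].
    * rewrite <- (pow2_abs h). right. field. lra.
  + pose proof (Rabs_pos K).
    apply Rle_lt_trans with ((Rabs K + 1) * Rabs h); [nra |].
    replace eps with ((Rabs K + 1) * (eps / (Rabs K + 1))) by (field; lra).
    apply Rmult_lt_compat_l; lra.
- rewrite flat_pos by lra.
  apply (is_derive_ext_loc (flat_deriv p n 0)).
  + apply (filter_imp (fun y => 0 < y)); [| now apply open_gt].
    intros y Hy. rewrite flat_pos; lra.
  + now apply is_derive_flat_deriv.
Qed.

(** * Gevrey bounds and the bump function *)

(** Up to a geometric factor this is [n!^s]; in this form it is submultiplicative in [n], which
    suits Leibniz's formula. *)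
Definition gevrey_bound (s A : R) (n : nat) : R :=
  A ^ n * Rpower (INR n + 1) (INR n * s).

Lemma gevrey_bound_mult (s A : R) (m n : nat) :
  0 <= s -> 0 <= A ->
  gevrey_bound s A m * gevrey_bound s A n <= gevrey_bound s A (m + n).
Proof.
intros Hs HA. unfold gevrey_bound.
pose proof (pos_INR m) as Hm. pose proof (pos_INR n) as Hn.
rewrite pow_add, plus_INR, Rmult_plus_distr_r, Rpower_plus.
assert (H : Rpower (INR m + 1) (INR m * s) * Rpower (INR n + 1) (INR n * s)
  <= Rpower (INR m + INR n + 1) (INR m * s) * Rpower (INR m + INR n + 1) (INR n * s)).
{ apply Rmult_le_compat; try (apply Rlt_le, exp_pos);
    apply Rle_Rpower_l; (split; lra) || (apply Rmult_le_pos; lra). }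
pose proof (pow_le A m HA). pose proof (pow_le A n HA).
replace (A ^ m * Rpower (INR m + 1) (INR m * s) *
  (A ^ n * Rpower (INR n + 1) (INR n * s)))
  with (A ^ m * A ^ n * (Rpower (INR m + 1) (INR m * s) * Rpower (INR n + 1) (INR n * s)))
  by ring.
apply Rmult_le_compat_l; [| exact H]. apply Rmult_le_pos; assumption.
Qed.

Lemma gevrey_bound_mono (s A B : R) (n : nat) :
  0 <= A <= B -> gevrey_bound s A n <= gevrey_bound s B n.
Proof.
intros H. unfold gevrey_bound. apply Rmult_le_compat_r; [apply Rlt_le, exp_pos |].
apply pow_incr; lra.
Qed.

Lemma flat_gevrey (p : R) :
  0 < p -> exists A, 0 < A /\
    forall n x, Rabs (flat p n x) <= gevrey_bound (1 + / p) A n.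
Proof.
intros Hp. assert (Hip : 0 < / p) by (apply Rinv_0_lt_compat; lra).
(* [B] is chosen so that [(1 + 1/p) * (n * (p+1) + 1) <= B * (n+1)]; the exponent
   [n * (p+1) / p = n * (1 + 1/p)] gives the Gevrey order. *)
set (B := (1 + / p) * (p + 1)).
assert (HB : 0 < B) by (unfold B; nra).
exists ((p + 1) * Rpower B (1 + / p)).
assert (HA : 0 < Rpower B (1 + / p)) by apply exp_pos.
split; [nra |]. intros n x.
apply Rle_trans with ((p + 1) ^ n * Rpower ((1 + / p) * (0 + INR n * (p + 1) + 1))
                         ((0 + INR n * (p + 1)) / p)).
- destruct (Rle_lt_dec x 0).
  + rewrite flat_neg, Rabs_R0 by lra.
    apply Rmult_le_pos; [apply pow_le; lra | apply Rlt_le, exp_pos].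
  + rewrite flat_pos by lra. apply flat_deriv_le; lra.
- unfold gevrey_bound. rewrite Rpow_mult_distr, Rmult_assoc.
  apply Rmult_le_compat_l; [apply pow_le; lra |].
  pose proof (pos_INR n) as Hn.
  rewrite <- Rpower_pow by exact HA. rewrite Rpower_mult.
  replace ((0 + INR n * (p + 1)) / p) with (INR n * (1 + / p)) by (field; lra).
  rewrite (Rmult_comm (1 + / p) (INR n)), Rpower_mult_distr by lra.
  assert (HnP : 0 <= INR n * (p + 1)) by nra.
  apply Rle_Rpower_l; [nra |]. split; [nra |].
  unfold B. rewrite Rmult_assoc. apply Rmult_le_compat_l; lra.
Qed.

(* The bump [exp (- (x - 1)^(-p) - (65/64 - x)^(-p))]. Its support [1, 65/64] is
   disjoint from its images under the iterates of [psi]; moreover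
   65/64 = psi (7/8). *)
Definition bump (p : R) (n : nat) : R -> R :=
  product_tower (fun k x => flat p k (x - 1))
                (fun k x => (- 1) ^ k * flat p k (65 / 64 - x)) n 0 0.

Lemma derivative_tower_bump (p : R) : 0 < p -> derivative_tower (bump p).
Proof.
intros Hp. apply derivative_tower_product; intros n x.
- replace (flat p (S n) (x - 1)) with (1 * flat p (S n) (x - 1)) by ring.
  apply (is_derive_comp (flat p n) (fun y => y - 1)).
  + now apply derivative_tower_flat.
  + auto_derive; [exact I | ring].
- replace ((- 1) ^ S n * flat p (S n) (65 / 64 - x))
    with ((- 1) ^ n * (- 1 * flat p (S n) (65 / 64 - x))) by (simpl; ring).
  apply is_derive_scal.
  apply (is_derive_comp (flat p n) (fun y => 65 / 64 - y)).
  + now apply derivative_tower_flat.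
  + auto_derive; [exact I | ring].
Qed.

Lemma bump_eq0 (p : R) (n : nat) (x : R) :
  x <= 1 \/ 65 / 64 <= x -> bump p n x = 0.
Proof.
intros H. apply product_tower_eq0. destruct H as [H | H]; [left | right]; intros k.
- apply flat_neg; lra.
- rewrite flat_neg by lra. ring.
Qed.

(** The [2^n] from Leibniz's formula is absorbed by doubling [A]. *)
Lemma bump_gevrey (p : R) :
  0 < p -> exists A, 0 < A /\
    forall n x, Rabs (bump p n x) <= gevrey_bound (1 + / p) A n.
Proof.
intros Hp. assert (Hip : 0 < / p) by (apply Rinv_0_lt_compat; lra).
destruct (flat_gevrey p Hp) as [A [HA H]].
exists (2 * A); split; [lra |]. intros n x.
replace (gevrey_bound (1 + / p) (2 * A) n)
  with (2 ^ n * gevrey_bound (1 + / p) A (n + 0 + 0))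
  by (rewrite !Nat.add_0_r; unfold gevrey_bound; rewrite Rpow_mult_distr; ring).
apply product_tower_le. intros i j.
rewrite Rabs_mult, <- RPow_abs, Rabs_m1, pow1, Rmult_1_l.
apply Rle_trans with (gevrey_bound (1 + / p) A i * gevrey_bound (1 + / p) A j).
- apply Rmult_le_compat; try apply Rabs_pos; apply H.
- apply gevrey_bound_mult; lra.
Qed.

(** Up to the midpoint [1 + 1/128] of the support, the factor that is flat at 65/64 is at least its
    value at the midpoint, which is the constant [c]. *)
Lemma bump_lower (p : R) :
  0 < p -> exists c, 0 < c /\
    forall h, 0 < h <= 1 / 128 -> c * exp (- Rpower h (- p)) <= bump p 0 (1 + h).
Proof.
intros Hp. exists (exp (- Rpower (1 / 128) (- p))); split; [apply exp_pos |].
intros h Hh. unfold bump; simpl.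
rewrite !flat_pos by lra. unfold flat_deriv.
rewrite !Ropp_0, !Rpower_O by lra.
replace (1 + h - 1) with h by ring.
assert (H : Rpower (65 / 64 - (1 + h)) (- p) <= Rpower (1 / 128) (- p)).
{ rewrite !Rpower_Ropp. apply Rinv_le_contravar; [apply exp_pos |].
  apply Rle_Rpower_l; lra. }
rewrite !Rmult_1_l, Rmult_comm.
apply Rmult_le_compat_l; [apply Rlt_le, exp_pos |].
apply exp_le_exp. lra.
Qed.

(** * Young conjugates and a membership criterion *)

(** Isolated so that one criterion serves both strong weights, through [young_conj_finite], and
    power weights, for which finiteness is checked directly. *)
Definition young_finite (omega : R -> R) : Prop :=
  forall s, 0 <= s ->
    is_finite (Lub_Rbar (fun r => exists t, 0 <= t /\ r = s * t - phi_ omega t)).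

Lemma young_conj_ge (omega : R -> R) (s t : R) :
  young_finite omega -> 0 <= s -> 0 <= t ->
  s * t - phi_ omega t <= young_conj omega s.
Proof.
intros W Hs Ht. unfold young_conj.
match goal with |- _ <= real (Lub_Rbar ?E) => destruct (Lub_Rbar_correct E) as [H _] end.
rewrite <- (W s Hs) in H. apply (H (s * t - phi_ omega t)). now exists t.
Qed.

Lemma phi_power_weight (d t : R) : phi_ (power_weight d) t = exp (t / d).
Proof.
unfold phi_, power_weight. destruct (Rle_dec (exp t) 0) as [H | H].
- pose proof (exp_pos t); lra.
- unfold Rpower. rewrite ln_exp. f_equal. unfold Rdiv; ring.
Qed.

Lemma young_power_weight_ub (d s : R) :
  0 < d -> 0 <= s ->
  is_ub_Rbar (fun r => exists t, 0 <= t /\ r = s * t - phi_ (power_weight d) t)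
    (d * s * ln (d * (s + 1))).
Proof.
intros Hd Hs r [t [Ht ->]]. simpl. rewrite phi_power_weight.
replace (s * t) with (d * s * (t / d)) by (field; lra).
apply mul_sub_exp_le; nra.
Qed.

Lemma young_finite_power_weight (d : R) : 0 < d -> young_finite (power_weight d).
Proof.
intros Hd s Hs.
match goal with |- is_finite (Lub_Rbar ?E) => set (S := E) end.
destruct (Lub_Rbar_correct S) as [Hub Hlub].
assert (H0 : S (s * 0 - phi_ (power_weight d) 0))
  by (exists 0; split; [lra | reflexivity]).
apply Hub in H0. specialize (Hlub _ (young_power_weight_ub d s Hd Hs)).
destruct (Lub_Rbar S); simpl in *; try reflexivity; contradiction.
Qed.

Lemma young_conj_power_weight_le (d s : R) :
  0 < d -> 0 <= s -> young_conj (power_weight d) s <= d * s * ln (d * (s + 1)).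
Proof.
intros Hd Hs. unfold young_conj.
pose proof (young_finite_power_weight d Hd s Hs) as Hf.
match goal with |- real (Lub_Rbar ?E) <= _ => destruct (Lub_Rbar_correct E) as [_ H] end.
specialize (H _ (young_power_weight_ub d s Hd Hs)). now rewrite <- Hf in H.
Qed.

(** A gap [g] between Gevrey orders beats any geometric factor [exp (k * E)]: either
    [ln (k+1) >= |E| / g] and the left side is nonpositive, or [k] is less than [exp (|E| / g)]. *)
Lemma mul_sub_ln_le (E g k : R) :
  0 < g -> 0 <= k -> k * (E - g * ln (k + 1)) <= Rabs E * exp (Rabs E / g).
Proof.
intros Hg Hk.
assert (HR : 0 <= Rabs E * exp (Rabs E / g))
  by (apply Rmult_le_pos; [apply Rabs_pos | apply Rlt_le, exp_pos]).
assert (HL : 0 <= ln (k + 1)) by (rewrite <- ln_1; apply ln_le; lra).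
pose proof (Rle_abs E) as HE.
destruct (Rle_lt_dec (Rabs E / g) (ln (k + 1))) as [H | H].
- apply Rle_trans with (2 := HR).
  assert (H1 : g * (Rabs E / g) <= g * ln (k + 1)) by (apply Rmult_le_compat_l; lra).
  replace (g * (Rabs E / g)) with (Rabs E) in H1 by (field; lra). nra.
- assert (Hk1 : k + 1 < exp (Rabs E / g)).
  { rewrite <- (exp_ln (k + 1)) by lra. now apply exp_increasing. }
  apply Rle_trans with (k * Rabs E).
  + apply Rmult_le_compat_l; [lra |]. nra.
  + rewrite Rmult_comm. apply Rmult_le_compat_l; [apply Rabs_pos | lra].
Qed.

(** Testing the Young conjugate at [t = d * ln (k+1)], where [phi_ omega t <= K * (k+1) + K], shows
    that the weight permits growth [(k+1)^(d*k)] up to geometric factors, and [s < d]. *)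
Lemma gelfand_shilov_of_gevrey (omega : R -> R) (d s A K r : R) (u : nat -> R -> R) :
  young_finite omega -> 0 < d -> 0 <= s < d -> 0 < A -> 0 <= K -> 0 <= r ->
  (forall t, 0 <= t -> phi_ omega t <= K * exp (t / d) + K) ->
  derivative_tower u ->
  (forall n x, Rabs (u n x) <= gevrey_bound s A n) ->
  (forall n x, r < Rabs x -> u n x = 0) ->
  gelfand_shilov omega (fun x => RtoC (u O x)).
Proof.
intros W Hd Hs HA HK Hr Hphi Hu Hbound Hsupp. split.
{ intros n x; split; simpl.
  - now apply derivative_tower_ex_derive_n.
  - apply ex_derive_n_const. }
intros la Hla.
(* [B] dominates both the Gevrey constant and [1 + |x|] on the support. After taking logarithms, the
   quantity to bound is at most [k * (E - (d - s) * ln (k+1)) + 2 * la * K] with [k = n + q]. *)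
set (B := A + (1 + r)). assert (HB : 0 < B) by (unfold B; lra).
set (E := ln B + la * K).
set (Bd := exp (Rabs E * exp (Rabs E / (d - s)) + 2 * la * K)).
apply Rbar_le_lt_trans with Bd; [| exact I].
apply (proj2 (Lub_Rbar_correct _)). intros y [x [n [q ->]]]. simpl.
unfold CDerive_n; simpl.
assert (H0 : Derive_n (fun _ => 0) n x = 0).
{ destruct n; [reflexivity |]. apply Derive_n_const. }
rewrite H0. change (Derive_n (fun y => u O y) n x) with (Derive_n (u O) n x).
rewrite (derivative_tower_Derive_n u n x Hu).
change (u n x, 0) with (RtoC (u n x)). rewrite Cmod_R.
destruct (Rlt_le_dec r (Rabs x)) as [Hx | Hx].
{ rewrite Hsupp, Rabs_R0 by exact Hx. rewrite Rmult_0_r, Rmult_0_l.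
  apply Rlt_le, exp_pos. }
set (k := (n + q)%nat).
pose proof (pos_INR k) as Hk.
assert (H1 : (1 + Rabs x) ^ q * Rabs (u n x) <= gevrey_bound s B k).
{ apply Rle_trans with (gevrey_bound s B q * gevrey_bound s B n).
  - apply Rmult_le_compat;
      [apply pow_le; pose proof (Rabs_pos x); lra | apply Rabs_pos | |].
    + apply Rle_trans with (B ^ q * 1).
      * rewrite Rmult_1_r. apply pow_incr.
        pose proof (Rabs_pos x). unfold B. lra.
      * unfold gevrey_bound. apply Rmult_le_compat_l; [apply pow_le; lra |].
        pose proof (pos_INR q).
        apply Rle_trans with (Rpower (INR q + 1) 0); [rewrite Rpower_O; lra |].
        apply Rle_Rpower; [lra |]. apply Rmult_le_pos; lra.
    + apply Rle_trans with (1 := Hbound n x).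
      apply gevrey_bound_mono. unfold B; lra.
  - unfold k. rewrite Nat.add_comm. apply gevrey_bound_mult; lra. }
assert (HL : 0 <= ln (INR k + 1)) by (rewrite <- ln_1; apply ln_le; lra).
assert (H2 : INR k / la * (d * ln (INR k + 1)) - (K * (INR k + 1) + K)
             <= young_conj omega (INR k / la)).
{ apply Rle_trans with
    (INR k / la * (d * ln (INR k + 1)) - phi_ omega (d * ln (INR k + 1))).
  - assert (H3 := Hphi (d * ln (INR k + 1)) ltac:(nra)).
    replace (d * ln (INR k + 1) / d) with (ln (INR k + 1)) in H3 by (field; lra).
    rewrite exp_ln in H3 by lra. lra.
  - apply young_conj_ge; [exact W | | nra].
    apply Rmult_le_pos; [exact Hk | apply Rlt_le, Rinv_0_lt_compat, Hla]. }
apply Rle_trans with (gevrey_bound s B k *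
  exp (- la * young_conj omega (INR k / la))).
{ apply Rmult_le_compat_r; [apply Rlt_le, exp_pos | exact H1]. }
unfold gevrey_bound. rewrite <- Rpower_pow by exact HB.
unfold Rpower. rewrite <- !exp_plus. apply exp_le_exp.
apply (Rmult_le_compat_l la) in H2; [| lra].
replace (la * (INR k / la * (d * ln (INR k + 1)) - (K * (INR k + 1) + K)))
  with (INR k * (d * ln (INR k + 1)) - la * (K * (INR k + 1) + K)) in H2
  by (field; lra).
generalize (mul_sub_ln_le E (d - s) (INR k) ltac:(lra) Hk). unfold E. lra.
Qed.

(** * Forward and backward iterates of psi *)

Lemma psi_ge (x : R) : x <= psi x.
Proof. unfold psi. generalize (pow2_ge_0 (x - 1 / 2)). lra. Qed.

Lemma psi_iter_le (m n : nat) (x : R) :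
  (m <= n)%nat -> psi_iter m x <= psi_iter n x.
Proof.
induction 1 as [| n _ IH]; [apply Rle_refl |].
apply Rle_trans with (1 := IH), psi_ge.
Qed.

Lemma continuous_psi_iter (m : nat) (x : R) : continuous (psi_iter m) x.
Proof.
induction m as [| m IH]; [apply continuous_id |].
apply (continuous_comp (psi_iter m) psi); [exact IH |].
apply (@ex_derive_continuous R_AbsRing R_NormedModule psi). unfold psi. auto_derive; exact I.
Qed.

Definition psi_inv (x : R) : R := sqrt (x - 1 / 4).

Definition psi_inv_iter (m : nat) : R -> R := Nat.iter m psi_inv.

(** Backward orbits approach the parabolic fixed point 1/2 no faster than [1/m]. With [c = 1/(m+5)],
    the induction step is [c + c^2 <= 1/(m+4)]. *)
Lemma psi_inv_iter_ge (m : nat) (x : R) :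
  3 / 4 <= x -> 1 / 2 + / (INR m + 4) <= psi_inv_iter m x.
Proof.
intros Hx. induction m as [| m IH]; [simpl; lra |].
rewrite S_INR. simpl. unfold psi_inv at 1. fold (psi_inv_iter m x).
pose proof (pos_INR m) as Hm.
assert (Hc : 0 < / (INR m + 5)) by (apply Rinv_0_lt_compat; lra).
replace (INR m + 1 + 4) with (INR m + 5) by ring.
rewrite <- (sqrt_pow2 (1 / 2 + / (INR m + 5))) by lra.
apply sqrt_le_1_alt. apply Rle_trans with (1 / 4 + / (INR m + 4)); [| lra].
assert (E : / (INR m + 4) - (/ (INR m + 5) + (/ (INR m + 5)) ^ 2)
            = / (INR m + 4) * (/ (INR m + 5)) ^ 2) by (field; lra).
assert (0 < / (INR m + 4) * (/ (INR m + 5)) ^ 2).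
{ apply Rmult_lt_0_compat; [apply Rinv_0_lt_compat; lra | apply pow_lt, Hc]. }
nra.
Qed.

Lemma psi_iter_inv (m : nat) (x : R) :
  3 / 4 <= x -> psi_iter m (psi_inv_iter m x) = x.
Proof.
intros Hx. induction m as [| m IH]; [reflexivity |].
(* One [psi] is peeled off on the inside, where it meets the outermost [psi_inv]. *)
unfold psi_iter. rewrite Nat.iter_succ_r. fold (psi_iter m).
transitivity (psi_iter m (psi_inv_iter m x)); [| exact IH]. f_equal.
pose proof (psi_inv_iter_ge m x Hx) as H.
assert (0 < / (INR m + 4)) by (apply Rinv_0_lt_compat; pose proof (pos_INR m); lra).
simpl. unfold psi, psi_inv at 1. fold (psi_inv_iter m x).
rewrite pow2_sqrt by lra. ring.
Qed.

(* The derivative of [psi_iter m] at [psi_inv_iter m x] is the product of the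
   [2 * psi_inv_iter j x] for [1 <= j <= m], and
   [1 + 2 / (j + 4) = (j + 6) / (j + 4)] telescopes: it is at least
   [(m + 5) (m + 6) / 30]. *)
Lemma psi_inv_iter_sub (m : nat) (x y : R) :
  3 / 4 <= x -> x < y ->
  0 < psi_inv_iter m y - psi_inv_iter m x
    <= 30 / ((INR m + 5) * (INR m + 6)) * (y - x).
Proof.
intros Hx Hxy. induction m as [| m IH]; [simpl; lra |].
pose proof (psi_inv_iter_ge m x Hx) as H.
pose proof (psi_inv_iter_ge m y ltac:(lra)) as H'.
pose proof (psi_inv_iter_ge (S m) x Hx) as H1.
pose proof (psi_inv_iter_ge (S m) y ltac:(lra)) as H1'.
rewrite S_INR in *. pose proof (pos_INR m) as Hm.
assert (0 < / (INR m + 4)) by (apply Rinv_0_lt_compat; lra).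
replace (INR m + 1 + 4) with (INR m + 5) in * by ring.
assert (Hc : 0 < / (INR m + 5)) by (apply Rinv_0_lt_compat; lra).
assert (Ex : psi_inv_iter (S m) x ^ 2 = psi_inv_iter m x - 1 / 4)
  by (simpl psi_inv_iter; unfold psi_inv; apply pow2_sqrt; fold (psi_inv_iter m x); lra).
assert (Ey : psi_inv_iter (S m) y ^ 2 = psi_inv_iter m y - 1 / 4)
  by (simpl psi_inv_iter; unfold psi_inv; apply pow2_sqrt; fold (psi_inv_iter m y); lra).
set (a := psi_inv_iter (S m) x) in *. set (b := psi_inv_iter (S m) y) in *.
set (a' := psi_inv_iter m x) in *. set (b' := psi_inv_iter m y) in *.
assert (Hp : (b - a) * (b + a) = b' - a') by (transitivity (b ^ 2 - a ^ 2); [ring | lra]).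
assert (Hab : 0 < b - a) by nra. split; [exact Hab |].
assert (H2 : (b - a) * ((INR m + 7) / (INR m + 5)) <= b' - a').
{ rewrite <- Hp. apply Rmult_le_compat_l; [lra |].
  replace ((INR m + 7) / (INR m + 5)) with (1 + 2 * / (INR m + 5)) by (field; lra). lra. }
apply Rmult_le_reg_r with ((INR m + 7) / (INR m + 5)).
{ apply Rdiv_lt_0_compat; lra. }
apply Rle_trans with (1 := H2). apply Rle_trans with (1 := proj2 IH).
right. field. lra.
Qed.

(** * The resolvent of the bump as a single term *)

Lemma is_series_single (a : nat -> R) (m : nat) :
  (forall k, k <> m -> a k = 0) -> is_series a (a m).
Proof.
intros H.
assert (E : forall n, sum_f_R0 a n = if le_dec m n then a m else 0).
{ induction n as [| n IH].
  - simpl. destruct (le_dec m 0) as [Hm | Hm].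
    + now replace m with O by lia.
    + apply H. lia.
  - simpl. rewrite IH.
    destruct (le_dec m n), (le_dec m (S n)); try lia.
    + rewrite (H (S n)) by lia. ring.
    + replace (S n) with m by lia. ring.
    + rewrite (H (S n)) by lia. ring. }
apply (filterlim_ext_loc (fun _ => a m)); [| apply filterlim_const].
exists m. intros n Hn. rewrite sum_n_Reals, E. destruct (le_dec m n); [reflexivity | lia].
Qed.

Lemma resolvent_single (mu : C) (f : R -> C) (m : nat) (x : R) :
  (forall k, k <> m -> f (psi_iter k x) = RtoC 0) ->
  resolvent mu f x = (f (psi_iter m x) / mu ^ S m)%C.
Proof.
intros H. unfold resolvent, CSeries, comp_op.
assert (H0 : forall k, k <> m -> (f (psi_iter k x) / mu ^ S k)%C = RtoC 0).
{ intros k Hk. rewrite H by exact Hk. unfold Cdiv. apply Cmult_0_l. }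
rewrite (is_series_unique _ _ (is_series_single
  (fun k => Re (f (psi_iter k x) / mu ^ S k)) m ltac:(intros k Hk; cbv beta; now rewrite H0))).
rewrite (is_series_unique _ _ (is_series_single
  (fun k => Im (f (psi_iter k x) / mu ^ S k)) m ltac:(intros k Hk; cbv beta; now rewrite H0))).
now destruct (f (psi_iter m x) / mu ^ S m)%C.
Qed.

(** Iterates increase with their index. Later ones are at least [psi (7/8) = 65/64]; for earlier
    ones, [psi t <= 65/64] forces [t <= 7/8]. The interval extends to the left of 1 so as to contain
    a region where the resolvent vanishes. *)
Lemma resolvent_bump (mu : C) (p : R) (m : nat) (x : R) :
  7 / 8 <= psi_iter m x <= 65 / 64 ->
  resolvent mu (fun y => RtoC (bump p 0 y)) x
    = (RtoC (bump p 0 (psi_iter m x)) / mu ^ S m)%C.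
Proof.
intros H. apply (resolvent_single mu (fun y => RtoC (bump p 0 y)) m x).
intros k Hk. f_equal. apply bump_eq0.
destruct (le_dec m k) as [Hmk | Hmk].
- right. apply Rle_trans with (psi_iter (S m) x); [| apply psi_iter_le; lia].
  change (65 / 64 <= psi (psi_iter m x)). unfold psi. nra.
- left. destruct m as [| m]; [lia |].
  apply Rle_trans with (psi_iter m x); [apply psi_iter_le; lia |].
  destruct H as [_ H]. change (psi (psi_iter m x) <= 65 / 64) in H.
  unfold psi in H. nra.
Qed.

(** * Lower bounds for the derivatives of the resolvent *)

(** The Taylor polynomial at [x] is zero, so only the Lagrange remainder is left. *)
Lemma taylor_flat (u : R -> R) (n : nat) (x y M : R) :
  (forall k t, ex_derive_n u k t) -> locally x (fun t => u t = 0) -> x < y ->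
  (forall t, Rabs (Derive_n u (S n) t) <= M) ->
  Rabs (u y) <= (y - x) ^ S n / INR (fact (S n)) * M.
Proof.
intros Hu H0 Hxy HM.
destruct (Taylor_Lagrange u n x y Hxy) as [z [_ E]]; [intros; apply Hu |].
assert (Hsum : sum_f_R0 (fun m => (y - x) ^ m / INR (fact m) * Derive_n u m x) n = 0).
{ rewrite <- (Rmult_0_l (INR (S n))), <- sum_cte. apply sum_eq.
  intros i _. assert (Ei : Derive_n u i x = 0).
  { rewrite (Derive_n_ext_loc u (fun _ => 0) i x H0).
    destruct i; [reflexivity | apply Derive_n_const]. }
  rewrite Ei. ring. }
rewrite E, Hsum, Rplus_0_l, Rabs_mult.
assert (Hq : 0 <= (y - x) ^ S n / INR (fact (S n))).
{ apply Rmult_le_pos; [apply pow_le; lra |].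
  apply Rlt_le, Rinv_0_lt_compat, INR_fact_lt_0. }
rewrite (Rabs_pos_eq _ Hq). apply Rmult_le_compat_l; [exact Hq | apply HM].
Qed.

Lemma Cmod_le_Rabs (z : C) : Cmod z <= Rabs (Re z) + Rabs (Im z).
Proof.
unfold Cmod. change (fst z) with (Re z). change (snd z) with (Im z).
rewrite <- (sqrt_pow2 (Rabs (Re z) + Rabs (Im z)))
  by (generalize (Rabs_pos (Re z)) (Rabs_pos (Im z)); lra).
apply sqrt_le_1_alt. rewrite <- (pow2_abs (Re z)), <- (pow2_abs (Im z)).
generalize (Rabs_pos (Re z)) (Rabs_pos (Im z)). nra.
Qed.

(** This is the seminorm with [lambda = 1], restricted to [q = 0]. *)
Lemma Sigma_space_derive_le (d : R) (f : R -> C) :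
  0 < d -> Sigma_space d f ->
  exists M, 1 <= M /\ forall n x,
    Cmod (CDerive_n f n x) <= M * exp (d * INR n * ln (d * (INR n + 1))).
Proof.
intros Hd [_ Hf]. specialize (Hf 1 Rlt_0_1). unfold gs_norm in Hf.
match type of Hf with context [Lub_Rbar ?E] =>
  pose proof (proj1 (Lub_Rbar_correct E)) as H; destruct (Lub_Rbar E) as [b | |] end;
  (* The supremum is not [m_infty], since the set contains the value at [x = 0], [n = q = 0]. *)
  [| contradiction | exfalso; refine (H _ (ex_intro _ 0 (ex_intro _ O (ex_intro _ O eq_refl))))].
exists (Rmax 1 b). split; [apply Rmax_l |]. intros n x.
assert (Hb := H _ (ex_intro _ x (ex_intro _ n (ex_intro _ O eq_refl)))).
simpl in Hb. rewrite Rmult_1_l, Nat.add_0_r, Rdiv_1_r in Hb.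
set (Y := young_conj (power_weight d) (INR n)) in Hb.
assert (HY : Y <= d * INR n * ln (d * (INR n + 1)))
  by (apply young_conj_power_weight_le; [exact Hd | apply pos_INR]).
apply Rle_trans with (b * exp Y).
- replace (Cmod (CDerive_n f n x)) with (Cmod (CDerive_n f n x) * exp (- 1 * Y) * exp Y).
  + apply Rmult_le_compat_r; [apply Rlt_le, exp_pos | exact Hb].
  + rewrite Rmult_assoc, <- exp_plus. replace (- 1 * Y + Y) with 0 by ring.
    rewrite exp_0. ring.
- apply Rle_trans with (Rmax 1 b * exp Y).
  + apply Rmult_le_compat_r; [apply Rlt_le, exp_pos | apply Rmax_r].
  + apply Rmult_le_compat_l; [generalize (Rmax_l 1 b); lra | now apply exp_le_exp].
Qed.

(** [taylor_flat] is applied between the preimages [x] and [y] of [1 - h] and [1 + h] under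
    [psi_iter m], which are at most [60 * h / (m+1)^2] apart. The factor 2 comes from treating real
    and imaginary parts separately. *)
Lemma resolvent_bump_derive_ge (mu : C) (p M h : R) (m n : nat) :
  1 < Cmod mu -> 0 < h <= 1 / 128 ->
  let g := resolvent mu (fun y => RtoC (bump p 0 y)) in
  smooth g -> (forall x, Cmod (CDerive_n g (S n) x) <= M) ->
  bump p 0 (1 + h) / Cmod mu ^ S m
    <= 2 * ((60 * h / (INR m + 1) ^ 2) ^ S n / INR (fact (S n)) * M).
Proof.
intros Hmu Hh g Hg HM.
set (x := psi_inv_iter m (1 - h)). set (y := psi_inv_iter m (1 + h)).
destruct (psi_inv_iter_sub m (1 - h) (1 + h) ltac:(lra) ltac:(lra)) as [Hxy Hd].
fold x y in Hxy, Hd.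
assert (Hx : psi_iter m x = 1 - h) by (apply psi_iter_inv; lra).
assert (Hy : psi_iter m y = 1 + h) by (apply psi_iter_inv; lra).
assert (Hmu0 : mu <> RtoC 0) by (intros ->; rewrite Cmod_0 in Hmu; lra).
assert (Hloc : locally x (fun t => g t = RtoC 0)).
{ assert (H1 : locally x (fun t => 7 / 8 < psi_iter m t)).
  { apply (continuous_psi_iter m x (fun t => 7 / 8 < t)). apply open_gt.
    rewrite Hx. lra. }
  assert (H2 : locally x (fun t => psi_iter m t < 1)).
  { apply (continuous_psi_iter m x (fun t => t < 1)). apply open_lt.
    rewrite Hx. lra. }
  generalize (filter_and _ _ H1 H2). apply filter_imp. intros t [Ht1 Ht2].
  unfold g. rewrite (resolvent_bump mu p m t) by lra.
  rewrite bump_eq0 by lra. unfold Cdiv. apply Cmult_0_l. }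
assert (E : Cmod (g y) = Rabs (bump p 0 (1 + h)) / Cmod mu ^ S m).
{ unfold g. rewrite (resolvent_bump mu p m y), Hy by lra.
  rewrite Cmod_div by (apply Cpow_nz; exact Hmu0).
  now rewrite Cmod_pow, Cmod_R. }
assert (HM0 : 0 <= M) by (apply Rle_trans with (2 := HM 0), Cmod_ge_0).
assert (H1 : Cmod (g y) <= 2 * ((y - x) ^ S n / INR (fact (S n)) * M)).
{ apply Rle_trans with (1 := Cmod_le_Rabs _).
  replace (2 * ((y - x) ^ S n / INR (fact (S n)) * M)) with
    ((y - x) ^ S n / INR (fact (S n)) * M + (y - x) ^ S n / INR (fact (S n)) * M) by ring.
  apply Rplus_le_compat.
  - apply (taylor_flat (fun t => Re (g t))).
    + intros k t. apply Hg.
    + revert Hloc; apply filter_imp; intros t ->; reflexivity.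
    + lra.
    + intros t. apply Rle_trans with (2 := HM t).
      apply (re_le_Cmod (CDerive_n g (S n) t)).
  - apply (taylor_flat (fun t => Im (g t))).
    + intros k t. apply Hg.
    + revert Hloc; apply filter_imp; intros t ->; reflexivity.
    + lra.
    + intros t. apply Rle_trans with (2 := HM t).
      exact (Rle_trans _ _ _ (Rmax_r _ _) (Rmax_Cmod (CDerive_n g (S n) t))). }
apply Rle_trans with (Cmod (g y)).
{ rewrite E. apply Rmult_le_compat_r; [| apply Rle_abs].
  apply Rlt_le, Rinv_0_lt_compat, pow_lt; lra. }
apply Rle_trans with (1 := H1).
apply Rmult_le_compat_l; [lra |]. apply Rmult_le_compat_r; [exact HM0 |].
apply Rmult_le_compat_r; [apply Rlt_le, Rinv_0_lt_compat, INR_fact_lt_0 |].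
apply pow_incr. split; [lra |]. apply Rle_trans with (1 := Hd).
pose proof (pos_INR m) as Hm.
replace (30 / ((INR m + 5) * (INR m + 6)) * (1 + h - (1 - h)))
  with (60 * h * / ((INR m + 5) * (INR m + 6))) by (field; lra).
apply Rmult_le_compat_l; [lra |].
apply Rinv_le_contravar; nra.
Qed.

Lemma resolvent_bump_not_Sigma (mu : C) (p d : R) :
  1 < Cmod mu -> 0 < p -> 0 < d -> d < 3 + / p ->
  ~ Sigma_space d (resolvent mu (fun x => RtoC (bump p 0 x))).
Proof.
intros Hmu Hp Hd Hdp HS.
destruct (Sigma_space_derive_le d _ Hd HS) as [M [HM1 HM]].
destruct HS as [Hsm _].
destruct (bump_lower p Hp) as [c [Hc Hlow]].
set (g := 3 + / p - d). assert (Hg : 0 < g) by (unfold g; lra).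
assert (HlM : 0 <= ln (2 * M)) by (rewrite <- ln_1; apply ln_le; lra).
assert (Hlmu : 0 <= ln (Cmod mu)) by (rewrite <- ln_1; apply ln_le; lra).
(* In the logarithm of the final inequality the terms in [N * ln N] combine to [g * N * ln N] on the
   left; [Q * N] dominates all the others. *)
set (Q := Rabs (ln c) + 1 + 2 * ln (Cmod mu) + ln (2 * M)
          + d * (Rabs (ln d) + ln 2) + ln 60 + 1).
(* [ln N > L] ensures both [ln N > Q / g], for the contradiction, and [h <= 1/128]. *)
set (L := Rmax (Q / g) (p * ln 128) + 1).
destruct (nfloor_ex (exp L) (Rlt_le _ _ (exp_pos _))) as [n [_ Hn]].
set (N := INR n + 1) in Hn. pose proof (pos_INR n) as Hn0.
assert (HlN : L < ln N) by (rewrite <- (ln_exp L); apply ln_increasing; [apply exp_pos | exact Hn]).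
assert (HN1 : 1 <= N) by (unfold N; lra).
assert (HlQ : Q / g < ln N) by (generalize (Rmax_l (Q / g) (p * ln 128)); unfold L in HlN; lra).
assert (Hlp : p * ln 128 < ln N)
  by (generalize (Rmax_r (Q / g) (p * ln 128)); unfold L in HlN; lra).
assert (Hip : 0 < / p) by (apply Rinv_0_lt_compat; lra).
(* With this [h] the flat factor [exp (- h^(-p))] is [exp (- N)], only a geometric loss. *)
set (h := Rpower N (- / p)).
assert (Hh : 0 < h <= 1 / 128).
{ split; [apply exp_pos |]. unfold h, Rpower.
  replace (1 / 128) with (exp (- ln 128)) by (rewrite exp_Ropp, exp_ln; lra).
  apply exp_le_exp. apply (Rmult_lt_compat_l (/ p)) in Hlp; [| lra].
  rewrite <- Rmult_assoc, Rinv_l in Hlp by lra. lra. }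
assert (Hhp : Rpower h (- p) = N).
{ unfold h. rewrite Rpower_mult. replace (- / p * - p) with 1 by (field; lra).
  apply Rpower_1; lra. }
assert (Hk := resolvent_bump_derive_ge mu p
  (M * exp (d * INR (S n) * ln (d * (INR (S n) + 1)))) h n n Hmu Hh Hsm
  (fun x => HM (S n) x)).
specialize (Hlow h Hh). rewrite Hhp in Hlow.
rewrite S_INR in Hk. fold N in Hk.
assert (HF := pow_self_le_fact (S n)). rewrite S_INR in HF. fold N in HF.
pose proof (INR_fact_lt_0 (S n)) as HFpos.
set (F := INR (fact (S n))) in *.
assert (EN : N = INR (S n)) by (unfold N; now rewrite S_INR).
assert (Epow : forall b, 0 < b -> b ^ S n = exp (N * ln b)).
{ intros b Hb. rewrite <- Rpower_pow by exact Hb. unfold Rpower. now rewrite <- EN. }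
rewrite !Epow in Hk; try lra; [| apply Rdiv_lt_0_compat; [lra | apply pow_lt; lra]].
rewrite Epow in HF by lra.
assert (HiF : / F <= exp (N - N * ln N)).
{ replace (N - N * ln N) with (- (N * ln N - N)) by ring. rewrite exp_Ropp.
  apply Rinv_le_contravar; [apply exp_pos |].
  unfold Rminus. rewrite exp_plus.
  apply Rmult_le_reg_r with (exp N); [apply exp_pos |].
  rewrite Rmult_assoc, <- exp_plus, Rplus_opp_l, exp_0. lra. }
assert (Elh : ln (60 * h / N ^ 2) = ln 60 - / p * ln N - 2 * ln N).
{ unfold Rdiv. rewrite ln_mult; [| lra | apply Rinv_0_lt_compat, pow_lt; lra].
  rewrite ln_mult, ln_Rinv, ln_pow by (try apply pow_lt; lra).
  unfold h, Rpower. rewrite ln_exp. simpl INR. ring. }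
rewrite Elh in Hk.
assert (Hfin : exp (ln c - N - N * ln (Cmod mu)) <=
  exp (ln (2 * M) + N * (ln 60 - / p * ln N - 2 * ln N) + (N - N * ln N)
       + d * N * ln (d * (N + 1)))).
{ apply Rle_trans with (bump p 0 (1 + h) / exp (N * ln (Cmod mu))).
  - replace (ln c - N - N * ln (Cmod mu)) with ((ln c + - N) + - (N * ln (Cmod mu))) by ring.
    rewrite exp_plus, exp_Ropp, exp_plus, exp_ln by lra.
    apply Rmult_le_compat_r; [apply Rlt_le, Rinv_0_lt_compat, exp_pos | exact Hlow].
  - apply Rle_trans with (1 := Hk). rewrite !exp_plus, exp_ln by lra.
    set (e1 := exp (N * (ln 60 - / p * ln N - 2 * ln N))) in *.
    set (e2 := exp (d * N * ln (d * (N + 1)))) in *.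
    assert (0 < e1) by apply exp_pos. assert (0 < e2) by apply exp_pos.
    replace (2 * (e1 / F * (M * e2))) with (2 * M * e1 * e2 * / F) by (field; lra).
    replace (2 * M * e1 * exp (N - N * ln N) * e2)
      with (2 * M * e1 * e2 * exp (N - N * ln N)) by ring.
    apply Rmult_le_compat_l; [| exact HiF].
    repeat apply Rmult_le_pos; lra. }
assert (Hfin' : ln c - N - N * ln (Cmod mu) <=
  ln (2 * M) + N * (ln 60 - / p * ln N - 2 * ln N) + (N - N * ln N)
       + d * N * ln (d * (N + 1))).
{ apply Rnot_lt_le. intros Hlt. apply exp_increasing in Hlt. lra. }
assert (HlN1 : ln (d * (N + 1)) <= Rabs (ln d) + ln 2 + ln N).
{ rewrite ln_mult by lra. generalize (Rle_abs (ln d)).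
  assert (ln (N + 1) <= ln (2 * N)) by (apply ln_le; lra).
  rewrite ln_mult in H by lra. lra. }
assert (HdN : d * N * ln (d * (N + 1)) <= d * N * (Rabs (ln d) + ln 2 + ln N))
  by (apply Rmult_le_compat_l; [nra | exact HlN1]).
assert (Hc' : - (N * Rabs (ln c)) <= ln c).
{ generalize (Rle_abs (- ln c)) (Rabs_pos (ln c)). rewrite Rabs_Ropp. nra. }
assert (HM' : ln (2 * M) <= N * ln (2 * M)) by nra.
assert (Hgl : N * (g * ln N) <= N * Q) by (unfold g, Q; nra).
apply Rmult_le_reg_l in Hgl; [| lra].
apply (Rmult_lt_compat_l g) in HlQ; [| exact Hg].
replace (g * (Q / g)) with Q in HlQ by (field; lra). lra.
Qed.

(** * Growth of strong weights *)

Lemma RInt_ge_cst (f : R -> R) (a b c : R) :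
  a <= b -> ex_RInt f a b -> (forall t, a < t < b -> c <= f t) ->
  c * (b - a) <= RInt f a b.
Proof.
intros Hab Hf Hc. apply Rle_trans with (RInt (fun _ => c) a b).
{ rewrite RInt_const. right. apply Rmult_comm. }
apply RInt_le; [exact Hab | apply ex_RInt_const | exact Hf | exact Hc].
Qed.

(** The integral over [[a, b]] is at most that over [[a, b']] for any [b' >= b], and [b'] can be
    taken so large that the latter is within [eps] of the limit. *)
Lemma RInt_le_RInt_gen (f : R -> R) (a b : R) :
  a <= b -> (forall t, a <= t -> continuous f t) -> (forall t, a <= t -> 0 <= f t) ->
  ex_RInt_gen f (at_point a) (Rbar_locally p_infty) ->
  RInt f a b <= RInt_gen f (at_point a) (Rbar_locally p_infty).
Proof.
intros Hab Hcont Hpos Hex.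
apply (RInt_gen_correct (V := R_CompleteNormedModule) f) in Hex.
set (I := RInt_gen f (at_point a) (Rbar_locally p_infty)) in *.
apply le_epsilon. intros eps Heps.
destruct (Hex (fun y => ball I (mkposreal eps Heps) y) (locally_ball _ _))
  as [P1 P2 H1 [T HT] H].
set (b' := Rmax b (T + 1)).
assert (Hb' : b <= b') by apply Rmax_l.
destruct (H a b' H1 (HT b' ltac:(generalize (Rmax_r b (T + 1)); unfold b'; lra)))
  as [y [Hy1 Hy2]]. simpl in Hy1.
assert (E1 : forall c d, a <= c -> c <= d -> ex_RInt f c d).
{ intros c d Hc Hd. apply (ex_RInt_continuous f). intros z Hz.
  rewrite Rmin_left in Hz by lra. apply Hcont. lra. }
apply is_RInt_unique in Hy1.
assert (E2 : RInt f a b + RInt f b b' = RInt f a b')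
  by (apply (RInt_Chasles f); apply E1; lra).
assert (E3 : 0 * (b' - b) <= RInt f b b').
{ apply RInt_ge_cst; [lra | apply E1; lra |]. intros t Ht. apply Hpos. lra. }
change (Rabs (y - I) < eps) in Hy2. apply Rabs_def2 in Hy2. simpl in *. lra.
Qed.

(* A quarter of the [k]-th term is at most the integral over [2^k, 2^(k+1)]. *)
Lemma strong_weight_dyadic (omega : R -> R) :
  strong_weight omega ->
  exists D, 2 <= D /\ forall (y : R) (n : nat), 0 < y ->
    sum_f_R0 (fun k => omega (2 ^ k * y) / 2 ^ k) n <= D * (omega y + 1).
Proof.
intros [W [C [HC Heps]]]. exists (4 * C); split; [lra |]. intros y n Hy.
destruct (Heps y Hy) as [Hex Hle].
set (f := fun t => omega (y * t) / t ^ 2) in *.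
assert (Hcont : forall t, 1 <= t -> continuous f t).
{ intros t Ht. unfold f, Rdiv. apply (continuous_mult (fun t => omega (y * t))).
  - apply (continuous_comp (fun t => y * t) omega).
    + apply (continuous_mult (fun _ => y) (fun t => t));
        [apply continuous_const | apply continuous_id].
    + assert (Hyt : 0 < y * t) by nra.
      intros P HP. specialize (weight_continuous _ W (y * t) ltac:(lra) P HP).
      unfold within, filtermap. intros HL.
      assert (HL2 : locally (y * t) (fun z => 0 < z)) by now apply open_gt.
      generalize (filter_and _ _ HL HL2). apply filter_imp.
      intros z [Hz1 Hz2]. apply Hz1. lra.
  - apply (@ex_derive_continuous R_AbsRing R_NormedModule (fun t => / t ^ 2)).
    auto_derive. nra. }
assert (Hpos : forall t, 1 <= t -> 0 <= f t).
{ intros t Ht. apply Rmult_le_pos; [apply (weight_ge0 _ W); nra |].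
  apply Rlt_le, Rinv_0_lt_compat, pow_lt; lra. }
assert (H2 : forall k, 1 <= 2 ^ k) by (intros k; apply pow_R1_Rle; lra).
assert (Hblock : forall k, omega (2 ^ k * y) / 2 ^ k / 4 <= RInt f (2 ^ k) (2 ^ S k)).
{ intros k. specialize (H2 k).
  replace (omega (2 ^ k * y) / 2 ^ k / 4)
    with (omega (2 ^ k * y) / (2 ^ S k) ^ 2 * (2 ^ S k - 2 ^ k))
    by (simpl; field; lra).
  simpl (2 ^ S k). apply RInt_ge_cst; [lra | |].
  - apply (ex_RInt_continuous f). intros z Hz. rewrite Rmin_left in Hz by lra.
    apply Hcont. lra.
  - intros t Ht. unfold f. rewrite (Rmult_comm y).
    apply Rmult_le_compat.
    + apply (weight_ge0 _ W). nra.
    + apply Rlt_le, Rinv_0_lt_compat, pow_lt; lra.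
    + apply (weight_increasing _ W); nra.
    + apply Rinv_le_contravar; [apply pow_lt; lra | apply pow_incr; lra]. }
assert (Hint : forall n, sum_f_R0 (fun k => omega (2 ^ k * y) / 2 ^ k) n
                         <= 4 * RInt f 1 (2 ^ S n)).
{ clear n. induction n as [| n IH].
  - generalize (Hblock O). simpl. rewrite !Rmult_1_r. lra.
  - assert (E : RInt f 1 (2 ^ S n) + RInt f (2 ^ S n) (2 ^ S (S n))
                = RInt f 1 (2 ^ S (S n))).
    { apply (RInt_Chasles f); apply (ex_RInt_continuous f); intros z Hz;
        apply Hcont; generalize (H2 (S n)) (H2 (S (S n))); intros ? ?.
      - rewrite Rmin_left in Hz by lra. lra.
      - generalize (Rmin_glb _ _ _ H H0). lra. }
    rewrite <- E, tech5. specialize (Hblock (S n)). lra. }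
apply Rle_trans with (1 := Hint n).
assert (H3 := RInt_le_RInt_gen f 1 (2 ^ S n) (H2 (S n)) Hcont Hpos Hex).
lra.
Qed.

(* The tails [T j] of the dyadic sum satisfy [T j <= D (T j - T (j+1) + 2^(-j))],
   so they decay geometrically. *)
Lemma strong_weight_geometric (omega : R -> R) :
  strong_weight omega ->
  exists Q th, 0 < Q /\ 1 / 2 < th < 1 /\
    forall n, omega (2 ^ n) <= Q * (2 * th) ^ n.
Proof.
intros HS. destruct (strong_weight_dyadic omega HS) as [D [HD H]].
destruct HS as [W _].
pose proof (weight_ge0 _ W) as Hge.
assert (HDi : 0 < / D <= 1 / 2).
{ split; [apply Rinv_0_lt_compat; lra |].
  replace (1 / 2) with (/ 2) by field. apply Rinv_le_contravar; lra. }
(* The recursion reads [T (j+1) <= (1 - 1/D) * T j + 2^(-j)]. Half of the gain [1/D] is kept for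
   [th]; the other half absorbs [2^(-j) <= th^j], which takes [Q >= 2 * D]. The remaining summand of
   [Q] bounds [T 0]. *)
set (th := 1 - / D / 2). set (Q := 2 * D + D * (omega 1 + 1)).
assert (Hth : 1 / 2 < th < 1) by (unfold th; lra).
assert (HQ : 2 * D <= Q) by (unfold Q; generalize (Hge 1 Rle_0_1); nra).
exists Q, th. split; [lra |]. split; [exact Hth |]. intros n.
set (a := fun k => omega (2 ^ k) / 2 ^ k).
assert (H2 : forall k, 0 < 2 ^ k) by (intros k; apply pow_lt; lra).
(* The tails are cut off at the fixed index [n], so that [T n] is the single term [a n] to be
   estimated. *)
set (T := fun j => sum_f_R0 (fun i => a (j + i)%nat) (n - j)).
assert (HT : forall j, T j <= D * (a j + / 2 ^ j)).
{ intros j. assert (Hj := H (2 ^ j) (n - j)%nat (H2 j)).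
  replace (T j) with
    (/ 2 ^ j * sum_f_R0 (fun k => omega (2 ^ k * 2 ^ j) / 2 ^ k) (n - j)).
  - replace (D * (a j + / 2 ^ j)) with (/ 2 ^ j * (D * (omega (2 ^ j) + 1)))
      by (unfold a; field; generalize (H2 j); lra).
    apply Rmult_le_compat_l; [apply Rlt_le, Rinv_0_lt_compat, H2 | exact Hj].
  - unfold T. rewrite scal_sum. apply sum_eq. intros i _. unfold a.
    rewrite pow_add, (Rmult_comm (2 ^ i)). field.
    split; apply Rgt_not_eq, H2. }
assert (Hstep : forall j, (j < n)%nat -> T (S j) = T j - a j).
{ intros j Hj. unfold T. replace (n - j)%nat with (S (n - S j)) by lia.
  rewrite (decomp_sum (fun i => a (j + i)%nat)) by lia. simpl pred.
  rewrite Nat.add_0_r.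
  rewrite (sum_eq (fun i => a (S j + i)%nat) (fun i => a (j + S i)%nat));
    [ring | intros i _; f_equal; lia]. }
assert (Hdecay : forall j, (j <= n)%nat -> T j <= Q * th ^ j).
{ induction j as [| j IH]; intros Hj.
  - apply Rle_trans with (1 := HT O). unfold a, Q. simpl. lra.
  - specialize (IH ltac:(lia)). rewrite Hstep by lia.
    assert (H3 : / D * T j <= a j + / 2 ^ j).
    { apply Rmult_le_reg_l with D; [lra |].
      rewrite <- Rmult_assoc, Rinv_r, Rmult_1_l by lra. apply HT. }
    assert (H4 : / 2 ^ j <= th ^ j).
    { rewrite <- pow_inv. apply pow_incr. lra. }
    assert (H5 : th ^ j <= Q * (/ D / 2) * th ^ j).
    { rewrite <- (Rmult_1_l (th ^ j)) at 1.
      apply Rmult_le_compat_r; [apply pow_le; lra |].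
      replace 1 with (2 * D * (/ D / 2)) by (field; lra).
      apply Rmult_le_compat_r; lra. }
    assert (H6 : (1 - / D) * T j <= (1 - / D) * (Q * th ^ j))
      by (apply Rmult_le_compat_l; lra).
    simpl pow. replace (Q * (th * th ^ j))
      with ((1 - / D) * (Q * th ^ j) + Q * (/ D / 2) * th ^ j)
      by (unfold th; field; lra).
    lra. }
specialize (Hdecay n (le_n n)). unfold T in Hdecay.
rewrite Nat.sub_diag in Hdecay. simpl in Hdecay. rewrite Nat.add_0_r in Hdecay.
unfold a in Hdecay. rewrite Rpow_mult_distr.
replace (omega (2 ^ n)) with (2 ^ n * (omega (2 ^ n) / 2 ^ n))
  by (field; apply Rgt_not_eq, H2).
replace (Q * (2 ^ n * th ^ n)) with (2 ^ n * (Q * th ^ n)) by ring.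
apply Rmult_le_compat_l; [apply Rlt_le, H2 | exact Hdecay].
Qed.

(** For [d = ln 2 / ln (2 * th)] one has [(2 * th)^n = (2^n)^(1/d)], and [th < 1] gives [d > 1].
    Monotonicity fills in between powers of 2. *)
Lemma strong_weight_growth (omega : R -> R) :
  strong_weight omega ->
  exists d K, 1 < d /\ 0 <= K /\
    forall t, 0 <= t -> phi_ omega t <= K * exp (t / d) + K.
Proof.
intros HS. destruct (strong_weight_geometric omega HS) as [Q [th [HQ [Hth H]]]].
destruct HS as [W _].
assert (Hl2 : 0 < ln 2) by (rewrite <- ln_1; apply ln_increasing; lra).
assert (Hlt : 0 < ln (2 * th) < ln 2).
{ split; [rewrite <- ln_1 |]; apply ln_increasing; lra. }
exists (ln 2 / ln (2 * th)), (Q * (2 * th)).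
split; [| split; [nra |]].
{ apply Rmult_lt_reg_r with (ln (2 * th)); [lra |].
  unfold Rdiv. rewrite Rmult_assoc, Rinv_l; lra. }
intros t Ht.
assert (Htl : 0 <= t / ln 2)
  by (apply Rmult_le_pos; [lra | apply Rlt_le, Rinv_0_lt_compat; lra]).
destruct (nfloor_ex (t / ln 2) Htl) as [n [Hn1 Hn2]].
assert (E : t / ln 2 * ln 2 = t) by (field; lra).
apply Rle_trans with (omega (2 ^ S n)).
- apply (weight_increasing _ W); [apply Rlt_le, exp_pos |].
  rewrite <- Rpower_pow by lra. apply exp_le_exp. rewrite S_INR, <- E.
  apply Rmult_le_compat_r; lra.
- apply Rle_trans with (1 := H (S n)).
  replace (Q * (2 * th) ^ S n) with (Q * (2 * th) * (2 * th) ^ n) by (simpl; ring).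
  apply Rle_trans with (Q * (2 * th) * exp (t / (ln 2 / ln (2 * th)))); [| nra].
  apply Rmult_le_compat_l; [nra |].
  rewrite <- Rpower_pow by lra. apply exp_le_exp.
  replace (t / (ln 2 / ln (2 * th))) with (t / ln 2 * ln (2 * th)) by (field; lra).
  apply Rmult_le_compat_r; lra.
Qed.

(** * Choice of the exponent and conclusion *)

Lemma bump_gelfand_shilov (omega : R -> R) (p d K : R) :
  young_finite omega -> 0 < p -> 1 + / p < d -> 0 <= K ->
  (forall t, 0 <= t -> phi_ omega t <= K * exp (t / d) + K) ->
  gelfand_shilov omega (fun x => RtoC (bump p 0 x)).
Proof.
intros W Hp Hd HK Hphi. assert (Hip : 0 < / p) by (apply Rinv_0_lt_compat; lra).
destruct (bump_gevrey p Hp) as [A [HA HbA]].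
apply (gelfand_shilov_of_gevrey omega d (1 + / p) A K 2 (bump p)); try assumption; try lra.
- now apply derivative_tower_bump.
- intros n x Hx. apply bump_eq0. unfold Rabs in Hx.
  destruct (Rcase_abs x); [left | right]; lra.
Qed.

Theorem theorem4p6 (mu : C) (hmu : 1 < Cmod mu) :
  (forall d : R, 1 < d < 2 ->
     forall omega : R -> R, strong_weight omega ->
     exists f : R -> C,
       gelfand_shilov omega f /\ ~ Sigma_space d (resolvent mu f)) /\
  (forall d d' : R, 1 < d -> 1 < d' -> d' < d + 2 ->
     exists f : R -> C,
       Sigma_space d f /\ ~ Sigma_space d' (resolvent mu f)).
Proof.
split.
- intros d Hd omega HS.
  destruct (strong_weight_growth omega HS) as [e [K [He [HK Hphi]]]].
  (* This makes [1 + 1/p] the midpoint of 1 and [e]. *)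
  set (p := 2 / (e - 1)).
  assert (Hp : 0 < p) by (apply Rdiv_lt_0_compat; lra).
  assert (Ep : / p = (e - 1) / 2) by (unfold p; field; lra).
  exists (fun x => RtoC (bump p 0 x)). split.
  + apply (bump_gelfand_shilov omega p e K); try assumption; [| lra].
    intros s Hs. apply young_conj_finite; [now destruct HS | exact Hs].
  + apply resolvent_bump_not_Sigma; lra.
- intros d d' Hd Hd' Hdd.
  set (m := Rmax 1 (d' - 2)).
  assert (Hm : 1 <= m /\ d' - 2 <= m) by (split; [apply Rmax_l | apply Rmax_r]).
  assert (Hmd : m < d) by (apply Rmax_lub_lt; lra).
  (* Now [1 + 1/p] is the midpoint of [m] and [d]: below [d] for membership, above [d' - 2] for
     [d' < 3 + 1/p]. *)
  set (p := / ((m + d) / 2 - 1)).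
  assert (Hp : 0 < p) by (apply Rinv_0_lt_compat; lra).
  assert (Ep : / p = (m + d) / 2 - 1) by (unfold p; field; lra).
  exists (fun x => RtoC (bump p 0 x)). split.
  + apply (bump_gelfand_shilov (power_weight d) p d 1); try lra.
    * apply young_finite_power_weight; lra.
    * intros t _. rewrite phi_power_weight. lra.
  + apply resolvent_bump_not_Sigma; lra.
Qed.
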